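(* Let $G$ be a finite group acting on a regular Hom-pre-Lie algebra $(A,\cdot,\alpha)$ over a field $\mathbb{K}$ of characteristic zero, and let $(\mathfrak{v}_t,\mathfrak{a}_t)=\{(\nu^H_t,\alpha^H_t)\}_{H\le G}$ be an equivariant one-parameter formal deformation of $A$. Then its equivariant infinitesimal $(\nu^G_1,\alpha^G_1)=(\oplus_{H\le G}\nu^H_1,\oplus_{H\le G}\alpha^H_1)$ is a $2$-cocycle of the equivariant $\alpha$-type cohomology of $A$, i.e. it is an invariant $2$-cochain with $\delta(\nu^G_1,\alpha^G_1)=0$.
   Context: A Hom-pre-Lie algebra $(A,\cdot,\alpha)$ is a $\mathbb{K}$-vector space $A$ with a bilinear product $\cdot$ and a linear map $\alpha:A\to A$ such that for all $a,b,c\in A$: $(a\cdot b)\cdot\alpha(c)-\alpha(a)\cdot(b\cdot c)=(b\cdot a)\cdot\alpha(c)-\alpha(b)\cdot(a\cdot c)$ and $\alpha(a\cdot b)=\alpha(a)\cdot\alpha(b)$; it is regular if $\alpha$ is invertible (standing assumption). A finite group $G$ acts on $A$ if there is a map $G\times A\to A$, $(g,a)\mapsto ga=\psi_g(a)$, with each $\psi_g$ linear, $ea=a$, $(g_1g_2)a=g_1(g_2a)$, $g(a\cdot b)=ga\cdot gb$ and $\alpha(ga)=g\alpha(a)$. For $H\le G$, $A^H=\{a\in A\mid ha=a\ \forall h\in H\}$ is a sub Hom-pre-Lie algebra. If $g\in G$ and $H,K\le G$ satisfy $g^{-1}Hg\subseteq K$, then $\psi_g$ restricts to a map $A^K\to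 A^H$. An equivariant one-parameter formal deformation of $A$ is a family $(\mathfrak{v}_t,\mathfrak{a}_t)=\{(\nu^H_t,\alpha^H_t)\}_{H\le G}$ of $\mathbb{K}[[t]]$-bilinear maps $\nu^H_t=\sum_{i\ge0}\nu^H_it^i:A^H[[t]]\times A^H[[t]]\to A^H[[t]]$ and $\mathbb{K}[[t]]$-linear maps $\alpha^H_t=\sum_{i\ge0}\alpha^H_it^i:A^H[[t]]\to A^H[[t]]$, with $\nu^H_i$ $\mathbb{K}$-bilinear and $\alpha^H_i$ $\mathbb{K}$-linear on $A^H$, such that for all $H\le G$ and $a,b,c\in A^H$: $\nu^H_0(a,b)=a\cdot b$, $\alpha^H_0(a)=\alpha(a)$; $\nu^H_t(\nu^H_t(a,b),\alpha^H_t(c))-\nu^H_t(\alpha^H_t(a),\nu^H_t(b,c))=\nu^H_t(\nu^H_t(b,a),\alpha^H_t(c))-\nu^H_t(\alpha^H_t(b),\nu^H_t(a,c))$; $\nu^H_t(\alpha^H_t(a),\alpha^H_t(b))=\alpha^H_t(\nu^H_t(a,b))$; and whenever $g^{-1}Hg\subseteq K$, $\nu^H_t\circ(\psi_g\otimes\psi_g)=\psi_g\circ\nu^K_t$ and $\alpha^H_t\circ\psi_g=\psi_g\circ\alpha^K_t$ on $A^K$ (naturality). Equivariant $\alpha$-type cohomology in low degree: for a Hom-pre-Lie algebra $B$, $\widetilde C^2(B,B)=\mathrm{Hom}(B^{\otimes2},B)\oplus\mathrm{Hom}(B,B)$, $\widetilde C^3(B,B)=\mathrm{Hom}(B^{\otimes3},B)\oplus\mathrm{Hom}(B^{\otimes2},B)$,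 and $\widetilde\partial(\varphi,\psi)=(\widetilde\partial_{\nu\nu}\varphi-\widetilde\partial_{\alpha\nu}\psi,\ \widetilde\partial_{\nu\alpha}\varphi-\widetilde\partial_{\alpha\alpha}\psi)$ with $(\widetilde\partial_{\nu\nu}\varphi)(a,b,c)=\alpha(a)\cdot\varphi(b,c)-\alpha(b)\cdot\varphi(a,c)+\varphi(b,a)\cdot\alpha(c)-\varphi(a,b)\cdot\alpha(c)-\varphi(\alpha(b),a\cdot c)+\varphi(\alpha(a),b\cdot c)-\varphi(a\cdot b,\alpha(c))+\varphi(b\cdot a,\alpha(c))$; $(\widetilde\partial_{\alpha\nu}\psi)(a,b,c)=\psi(b)\cdot(a\cdot c)-\psi(a)\cdot(b\cdot c)+(a\cdot b)\cdot\psi(c)-(b\cdot a)\cdot\psi(c)$; $(\widetilde\partial_{\nu\alpha}\varphi)(a,b)=\alpha(\varphi(a,b))-\varphi(\alpha(a),\alpha(b))$; $(\widetilde\partial_{\alpha\alpha}\psi)(a,b)=\alpha(a)\cdot\psi(b)+\psi(a)\cdot\alpha(b)-\psi(a\cdot b)$. An $n$-cochain is a family $c=\{(c^H_\nu,c^H_\alpha)\}_{H\le G}\in\bigoplus_{H\le G}\widetilde C^n(A^H,A^H)$; it is invariant if whenever $g^{-1}Hg\subseteq K$, $c^H_\nu\circ\psi_g^{\otimes n}=\psi_g\circ c^K_\nu$ and $c^H_\alpha\circ\psi_g^{\otimes(n-1)}=\psi_g\circ c^K_\alpha$ on tensor powers of $A^K$. The equivariant complex consists of invariant cochains with differential $\delta$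 given by applying $\widetilde\partial$ of $A^H$ in each component $H$. *)

(* Defs.v *)
From HB Require Import structures.
From mathcomp Require Import all_boot all_order all_algebra all_fingroup.

Set Implicit Arguments.
Unset Strict Implicit.
Unset Printing Implicit Defensive.

Import GRing.Theory.
Local Open Scope ring_scope.

HB.mixin Record Lmodule_isHomPreLie (K : fieldType) A of GRing.Lmodule K A := {
  hmul : {bilinear A -> A -> A};
  halpha : {linear A -> A};
  hmul_preLie : forall a b c : A,
    hmul (hmul a b) (halpha c) - hmul (halpha a) (hmul b c)
    = hmul (hmul b a) (halpha c) - hmul (halpha b) (hmul a c);
  halphaM : forall a b : A, halpha (hmul a b) = hmul (halpha a) (halpha b)
}.

#[short(type="homPreLieType")]
HB.structure Definition HomPreLie (K : fieldType) :=
  {A of GRing.Lmodule K A & Lmodule_isHomPreLie K A}.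

Notation "a *h b" := (hmul a b) (at level 40, left associativity).

Definition regular (K : fieldType) (A : homPreLieType K) : Prop :=
  bijective (halpha : A -> A).

Record hpl_action (K : fieldType) (G : finGroupType) (A : homPreLieType K) :=
  HplAction {
    act_fun :> G -> {linear A -> A};
    act1 : forall a, act_fun 1%g a = a;
    actM : forall g1 g2 a, act_fun (g1 * g2)%g a = act_fun g1 (act_fun g2 a);
    act_hmul : forall g a b, act_fun g (a *h b) = act_fun g a *h act_fun g b;
    act_halpha : forall g a, halpha (act_fun g a) = act_fun g (halpha a)
  }.

Section FixedPoints.
Variables (K : fieldType) (G : finGroupType) (A : homPreLieType K).
Variable psi : hpl_action G A.

Definition fixed_pred (H : {group G}) : {pred A} :=
  [pred a | [forall h in H, psi h a == a]].

Lemma fixedP (H : {group G}) a :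
  reflect (forall h, h \in H -> psi h a = a) (a \in fixed_pred H).
Proof.
by apply: (iffP forall_inP) => fixa h /fixa => [/eqP | /eqP].
Qed.

Section FixedType.
Variable H : {group G}.

Fact fixed_submod_closed : submod_closed (fixed_pred H).
Proof.
split=> [|k a b /fixedP fa /fixedP fb]; apply/fixedP => h hH.
  by rewrite linear0.
by rewrite linearP fa // fb.
Qed.

HB.instance Definition _ :=
  GRing.isSubmodClosed.Build K A (fixed_pred H) fixed_submod_closed.

(* A^H *)
Record fixed : Type := Fixed { fixed_val : A; _ : fixed_val \in fixed_pred H }.

HB.instance Definition _ := [isSub for fixed_val].
HB.instance Definition _ := [Choice of fixed by <:].
HB.instance Definition _ := [SubChoice_isSubLmodule of fixed by <:].

Fact fixed_mul_subproof (a b : fixed) : val a *h val b \in fixed_pred H.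
Proof.
apply/fixedP => h hH; rewrite act_hmul.
by rewrite (fixedP _ _ (valP a)) // (fixedP _ _ (valP b)).
Qed.

Definition fixed_mul (a b : fixed) : fixed := Fixed (fixed_mul_subproof a b).

Fact fixed_mul_is_bilinear :
  bilinear_for (GRing.Scale.Law.clone _ _ *:%R _)
               (GRing.Scale.Law.clone _ _ *:%R _) fixed_mul.
Proof.
split=> [c|c] k a b; apply: val_inj; rewrite /=.
  by rewrite linearPl.
by rewrite linearPr.
Qed.

HB.instance Definition _ :=
  bilinear_isBilinear.Build K fixed fixed fixed _ _ fixed_mul
    fixed_mul_is_bilinear.

Fact fixed_alpha_subproof (a : fixed) : halpha (val a) \in fixed_pred H.
Proof.
by apply/fixedP => h hH; rewrite -act_halpha (fixedP _ _ (valP a)).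
Qed.

Definition fixed_alpha (a : fixed) : fixed := Fixed (fixed_alpha_subproof a).

Fact fixed_alpha_is_linear : linear fixed_alpha.
Proof. by move=> k a b; apply: val_inj; rewrite /= linearP. Qed.

HB.instance Definition _ :=
  GRing.isLinear.Build K fixed fixed _ fixed_alpha fixed_alpha_is_linear.

Fact fixed_preLie (a b c : fixed) :
  fixed_mul (fixed_mul a b) (fixed_alpha c)
    - fixed_mul (fixed_alpha a) (fixed_mul b c)
  = fixed_mul (fixed_mul b a) (fixed_alpha c)
    - fixed_mul (fixed_alpha b) (fixed_mul a c).
Proof. by apply: val_inj; rewrite !linearB; exact: hmul_preLie. Qed.

Fact fixed_alphaM (a b : fixed) :
  fixed_alpha (fixed_mul a b) = fixed_mul (fixed_alpha a) (fixed_alpha b).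
Proof. by apply: val_inj; exact: halphaM. Qed.

HB.instance Definition _ :=
  @Lmodule_isHomPreLie.Build K fixed fixed_mul fixed_alpha
    fixed_preLie fixed_alphaM.

End FixedType.

(* H :^ g is g^-1 H g *)
Fact act_res_subproof (g : G) (H L : {group G}) (sHL : (H :^ g)%g \subset L)
  (a : fixed L) : psi g (val a) \in fixed_pred H.
Proof.
apply/fixedP => h hH; rewrite -actM.
have -> : (h * g = g * (h ^ g))%g by rewrite conjgE !mulgA mulgV mul1g.
rewrite actM (fixedP _ _ (valP a)) //.
by apply: (subsetP sHL); rewrite memJ_conjg.
Qed.

Definition act_res (g : G) (H L : {group G}) (sHL : (H :^ g)%g \subset L)
  (a : fixed L) : fixed H := Fixed (act_res_subproof sHL a).

End FixedPoints.

(* V[[t]], as sequences of coefficients *)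
Definition series (V : Type) : Type := nat -> V.

Definition series_const (V : nmodType) (a : V) : series V :=
  fun n => if n is 0 then a else 0.

Definition series_map (V W : Type) (f : V -> W) (x : series V) : series W :=
  fun n => f (x n).

Definition series_add (V : nmodType) (x y : series V) : series V :=
  fun n => x n + y n.

(* the K[[t]]-module structure of V[[t]] *)
Definition series_scale (K : fieldType) (V : lmodType K)
    (s : series K) (x : series V) : series V :=
  fun n => \sum_(i < n.+1) s i *: x (n - i)%N.

(* The K[[t]]-linear map \sum_i f_i t^i : V[[t]] -> W[[t]]. *)
Definition series_lin (K : fieldType) (V W : lmodType K)
    (f : nat -> {linear V -> W}) (x : series V) : series W :=
  fun n => \sum_(i < n.+1) f i (x (n - i)%N).

(* The K[[t]]-bilinear map \sum_i m_i t^i : U[[t]] x V[[t]] -> W[[t]]. *)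
Definition series_bilin (K : fieldType) (U V W : lmodType K)
    (m : nat -> {bilinear U -> V -> W}) (x : series U) (y : series V) :
    series W :=
  fun n => \sum_(i < n.+1) \sum_(j < (n - i).+1) m i (x j) (y (n - i - j)%N).

Section SeriesTheory.

Lemma triangle_exchange (V : nmodType) n (F : nat -> nat -> V) :
  \sum_(i < n.+1) \sum_(j < (n - i).+1) F i j
  = \sum_(j < n.+1) \sum_(i < (n - j).+1) F i j.
Proof.
have E (F' : nat -> nat -> V) : \sum_(i < n.+1) \sum_(j < (n - i).+1) F' i j
    = \sum_(i < n.+1) \sum_(j < n.+1 | (i + j <= n)%N) F' i j.
  apply: eq_bigr => i _.
  rewrite (big_ord_widen n.+1 (F' i)) ?ltnS ?leq_subr //.
  by apply: eq_bigl => j; rewrite ltnS leq_subRL // -ltnS.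
rewrite E (E (fun j i => F i j)) (exchange_big_dep xpredT) //=.
by apply: eq_bigr => j _; apply: eq_bigl => i; rewrite addnC.
Qed.

Variables (K : fieldType) (U V W : lmodType K).

Lemma series_linD (f : nat -> {linear V -> W}) x y :
  series_lin f (series_add x y) =1 series_add (series_lin f x) (series_lin f y).
Proof.
by move=> n; rewrite /series_add -big_split; apply: eq_bigr => i _; rewrite linearD.
Qed.

Lemma series_linZ (f : nat -> {linear V -> W}) s x :
  series_lin f (series_scale s x) =1 series_scale s (series_lin f x).
Proof.
move=> n; rewrite /series_lin /series_scale.
under eq_bigr do rewrite linear_sum.
rewrite (triangle_exchange n (fun i j => f i (s j *: x (n - i - j)%N))).
apply: eq_bigr => j _; rewrite scaler_sumr; apply: eq_bigr => i _.
by rewrite linearZ subnAC.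
Qed.

Variable m : nat -> {bilinear U -> V -> W}.

Lemma series_bilinDl x x' y :
  series_bilin m (series_add x x') y
  =1 series_add (series_bilin m x y) (series_bilin m x' y).
Proof.
move=> n; rewrite /series_add /series_bilin -big_split; apply: eq_bigr => i _.
by rewrite -big_split; apply: eq_bigr => j _; rewrite linearDl.
Qed.

Lemma series_bilinDr x y y' :
  series_bilin m x (series_add y y')
  =1 series_add (series_bilin m x y) (series_bilin m x y').
Proof.
move=> n; rewrite /series_add /series_bilin -big_split; apply: eq_bigr => i _.
by rewrite -big_split; apply: eq_bigr => j _; rewrite linearDr.
Qed.

Lemma series_bilinZr s x y :
  series_bilin m x (series_scale s y) =1 series_scale s (series_bilin m x y).
Proof.
move=> n; rewrite /series_bilin /series_scale.
pose F i k := \sum_(j < (n - i - k).+1) s k *: m i (x j) (y (n - i - k - j)%N).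
rewrite (eq_bigr (fun i : 'I_n.+1 => \sum_(k < (n - i).+1) F i k)) => [|i _].
  rewrite (triangle_exchange n F); apply: eq_bigr => k _; rewrite scaler_sumr.
  apply: eq_bigr => i _; rewrite /F scaler_sumr subnAC.
  by apply: eq_bigr.
under eq_bigr do rewrite linear_sumr.
rewrite (triangle_exchange (n - i)
  (fun j k => m i (x j) (s k *: y (n - i - j - k)%N))).
apply: eq_bigr => k _; apply: eq_bigr => j _.
by rewrite linearZr_LR (subnAC (n - i)%N).
Qed.

Lemma series_bilinZl s x y :
  series_bilin m (series_scale s x) y =1 series_scale s (series_bilin m x y).
Proof.
have flip N (F : nat -> nat -> W) :
    \sum_(j < N.+1) F j (N - j)%N = \sum_(j < N.+1) F (N - j)%N j.
  rewrite (reindex_inj rev_ord_inj) /=; apply: eq_bigr => j _.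
  by rewrite subSS subKn // -ltnS.
move=> n; rewrite /series_bilin /series_scale.
pose F i k := \sum_(j < (n - i - k).+1) s k *: m i (x (n - i - k - j)%N) (y j).
rewrite (eq_bigr (fun i : 'I_n.+1 => \sum_(k < (n - i).+1) F i k)) => [|i _].
  rewrite (triangle_exchange n F); apply: eq_bigr => k _; rewrite scaler_sumr.
  apply: eq_bigr => i _; rewrite (flip _ (fun a b => m i (x a) (y b))).
  by rewrite /F scaler_sumr subnAC.
rewrite (flip _ (fun a b =>
  m i (\sum_(k < a.+1) s k *: x (a - k)%N) (y b))).
under eq_bigr do rewrite linear_sumlz.
rewrite (triangle_exchange (n - i)
  (fun j k => m i (s k *: x (n - i - j - k)%N) (y j))).
apply: eq_bigr => k _; apply: eq_bigr => j _.
by rewrite linearZl_LR (subnAC (n - i)%N).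
Qed.

End SeriesTheory.

(* An identity in A^H[[t]] is stated coefficientwise with =1; a, b, c range over
   A^H, seen in A^H[[t]] as constant series. *)
Record eqv_deformation (K : fieldType) (G : finGroupType) (A : homPreLieType K)
    (psi : hpl_action G A) := EqvDeformation {
  def_nu : forall H : {group G},
    nat -> {bilinear (fixed psi H) -> (fixed psi H) -> (fixed psi H)};
  def_alpha : forall H : {group G},
    nat -> {linear (fixed psi H) -> (fixed psi H)};
  nut := fun H => series_bilin (def_nu H);
  alphat := fun H => series_lin (def_alpha H);
  cst := fun H (a : fixed psi H) => series_const a;
  def_nu0 : forall H (a b : fixed psi H), def_nu H 0 a b = a *h b;
  def_alpha0 : forall H (a : fixed psi H), def_alpha H 0 a = halpha a;
  def_preLie : forall H (a b c : fixed psi H) n,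
    nut (nut (cst a) (cst b)) (alphat (cst c)) n
      - nut (alphat (cst a)) (nut (cst b) (cst c)) n
    = nut (nut (cst b) (cst a)) (alphat (cst c)) n
      - nut (alphat (cst b)) (nut (cst a) (cst c)) n;
  def_mult : forall H (a b : fixed psi H),
    nut (alphat (cst a)) (alphat (cst b)) =1 alphat (nut (cst a) (cst b));
  def_nu_nat : forall g (H L : {group G}) (sHL : (H :^ g)%g \subset L)
      (a b : fixed psi L),
    nut (cst (act_res sHL a)) (cst (act_res sHL b))
    =1 series_map (act_res sHL) (nut (cst a) (cst b));
  def_alpha_nat : forall g (H L : {group G}) (sHL : (H :^ g)%g \subset L)
      (a : fixed psi L),
    alphat (cst (act_res sHL a)) =1 series_map (act_res sHL) (alphat (cst a))
}.

(* C~^2(B, B) *)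
Definition cochain2 (K : fieldType) (B : lmodType K) : Type :=
  ({bilinear B -> B -> B} * {linear B -> B})%type.

Definition trilinear_for (K : fieldType) (B : lmodType K)
    (f : B -> B -> B -> B) : Prop :=
  [/\ forall b c, linear (fun a => f a b c),
      forall a c, linear (fun b => f a b c)
    & forall a b, linear (fun c => f a b c)].

Record trilinear (K : fieldType) (B : lmodType K) := Trilinear {
  tri_fun :> B -> B -> B -> B;
  triP : trilinear_for tri_fun
}.

(* C~^3(B, B) *)
Definition cochain3 (K : fieldType) (B : lmodType K) : Type :=
  (trilinear B * {bilinear B -> B -> B})%type.

Definition cochain3_eq0 (K : fieldType) (B : lmodType K) (c : cochain3 B) :
    Prop :=
  (forall x y z, c.1 x y z = 0) /\ (forall x y, c.2 x y = 0).

Section Differential.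
Variables (K : fieldType) (B : homPreLieType K).

Section Components.
Variables (phi : B -> B -> B) (chi : B -> B).

Definition d_nunu (a b c : B) : B :=
  halpha a *h phi b c - halpha b *h phi a c
  + phi b a *h halpha c - phi a b *h halpha c
  - phi (halpha b) (a *h c) + phi (halpha a) (b *h c)
  - phi (a *h b) (halpha c) + phi (b *h a) (halpha c).

Definition d_alphanu (a b c : B) : B :=
  chi b *h (a *h c) - chi a *h (b *h c)
  + (a *h b) *h chi c - (b *h a) *h chi c.

Definition d_nualpha (a b : B) : B :=
  halpha (phi a b) - phi (halpha a) (halpha b).

Definition d_alphaalpha (a b : B) : B :=
  halpha a *h chi b + chi a *h halpha b - chi (a *h b).

End Components.

Lemma linear_addf (U V : lmodType K) (f g : U -> V) :
  linear f -> linear g -> linear (fun x => f x + g x).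
Proof. by move=> lf lg k x y; rewrite lf lg scalerDr addrACA. Qed.

Lemma linear_subf (U V : lmodType K) (f g : U -> V) :
  linear f -> linear g -> linear (fun x => f x - g x).
Proof. by move=> lf lg k x y; rewrite lf lg scalerBr opprD addrACA. Qed.

Section Total.
Variables (phi : {bilinear B -> B -> B}) (chi : {linear B -> B}).

Definition dt_nu (a b c : B) : B := d_nunu phi a b c - d_alphanu chi a b c.

Definition dt_alpha (a b : B) : B := d_nualpha phi a b - d_alphaalpha chi a b.

Fact dt_nu_trilinear : trilinear_for dt_nu.
Proof.
rewrite /dt_nu /d_nunu /d_alphanu.
by split=> u v; do ?[apply: linear_subf | apply: linear_addf] => k x y;
  do !rewrite ?linearPl ?linearPr ?linearP.
Qed.

Fact dt_alpha_bilinear :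
  bilinear_for (GRing.Scale.Law.clone _ _ *:%R _)
               (GRing.Scale.Law.clone _ _ *:%R _) dt_alpha.
Proof.
rewrite /dt_alpha /d_nualpha /d_alphaalpha.
by split=> u; do ?[apply: linear_subf | apply: linear_addf] => k x y;
  do !rewrite ?linearPl ?linearPr ?linearP.
Qed.

HB.instance Definition _ :=
  bilinear_isBilinear.Build K B B B _ _ dt_alpha dt_alpha_bilinear.

End Total.

Definition dtilde (c : cochain2 B) : cochain3 B :=
  (Trilinear (dt_nu_trilinear c.1 c.2),
   dt_alpha c.1 c.2 : {bilinear B -> B -> B}).

End Differential.

Section Equivariant.
Variables (K : fieldType) (G : finGroupType) (A : homPreLieType K).
Variable psi : hpl_action G A.

(* G has finitely many subgroups, so their direct sum is the product. *)
Definition eqv_cochain2 : Type := forall H : {group G}, cochain2 (fixed psi H).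

Definition eqv_cochain3 : Type := forall H : {group G}, cochain3 (fixed psi H).

Definition invariant2 (c : eqv_cochain2) : Prop :=
  forall g (H L : {group G}) (sHL : (H :^ g)%g \subset L),
    (forall a b : fixed psi L,
        (c H).1 (act_res sHL a) (act_res sHL b) = act_res sHL ((c L).1 a b))
    /\ (forall a : fixed psi L,
        (c H).2 (act_res sHL a) = act_res sHL ((c L).2 a)).

Definition eqv_delta (c : eqv_cochain2) : eqv_cochain3 :=
  fun H => dtilde (c H).

Definition eqv_cocycle2 (c : eqv_cochain2) : Prop :=
  invariant2 c /\ forall H, cochain3_eq0 (eqv_delta c H).

Definition infinitesimal (D : eqv_deformation psi) : eqv_cochain2 :=
  fun H => (def_nu D H 1, def_alpha D H 1).

End Equivariant.

(* Main.v *)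
Require Import Defs.
From HB Require Import structures.
From mathcomp Require Import all_boot all_order all_algebra all_fingroup.

(** A formal deformation satisfies its defining identities in [A^H[[t]]], hence
    coefficient by coefficient. The coefficient of t in a composite of maps
    sum_i f_i t^i collects the ways of taking one first-order term [nu_1] or
    [alpha_1] and otherwise the undeformed maps [nu_0] (the product) and
    [alpha_0] (the twist). Naturality involves no composition of deformed maps,
    so its coefficient of t is precisely the invariance of the infinitesimal.
    For the Hom-pre-Lie identity, this coefficient of the right-hand side minus
    that of the left-hand side is the component of the differential in
    Hom(B^{(x)3}, B), where B = A^H ([dt_nu_deformation]); for
    multiplicativity it is the component in Hom(B^{(x)2}, B)
    ([dt_alpha_deformation]). Both differences vanish since the identities
    hold for the deformation. *)

Set Implicit Arguments.
Unset Strict Implicit.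
Unset Printing Implicit Defensive.

Import GRing.Theory.
Local Open Scope ring_scope.

Section Coefficients.
Variables (K : fieldType) (U V W : lmodType K).
Variables (f : nat -> {linear V -> W}) (m : nat -> {bilinear U -> V -> W}).

(** A constant series has no positive-degree term, so only the summand in
    which f contributes the whole power [t^n] survives. *)
Lemma series_lin_const a n : series_lin f (series_const a) n = f n a.
Proof.
rewrite /series_lin big_ord_recr /= subnn /= big1 ?add0r // => i _.
by rewrite -[(n - i)%N]prednK ?subn_gt0 //= linear0.
Qed.

Lemma series_bilin_const a b n :
  series_bilin m (series_const a) (series_const b) n = m n a b.
Proof.
rewrite /series_bilin big_ord_recr /= subnn big_ord1 /= big1 ?add0r // => i _.
apply: big1 => -[[|j] jP] _ /=; last by rewrite linear0l.
by rewrite subn0 -[(n - i)%N]prednK ?subn_gt0 //= linear0r.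
Qed.

Lemma series_lin_coef1 x : series_lin f x 1 = f 0 (x 1) + f 1 (x 0).
Proof. by rewrite /series_lin !big_ord_recr big_ord0 /= add0r. Qed.

Lemma series_bilin_coef1 x y :
  series_bilin m x y 1 = m 0 (x 0) (y 1) + m 0 (x 1) (y 0) + m 1 (x 0) (y 0).
Proof. by rewrite /series_bilin big_ord_recr big_ord1 big_ord_recr !big_ord1. Qed.

End Coefficients.

Section Infinitesimal.
Variables (K : fieldType) (G : finGroupType) (A : homPreLieType K).
Variables (psi : hpl_action G A) (D : eqv_deformation psi).

(** The Hom-pre-Lie identity at order t. The differential has the sign of its
    right-hand side minus its left-hand side. *)
Lemma dt_nu_deformation (H : {group G}) (a b c : fixed psi H) :
  dt_nu (def_nu D H 1) (def_alpha D H 1) a b c = 0.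
Proof.
have := def_preLie D a b c 1.
(* Only the outer products are expanded at order t: the inner ones take
   constant arguments, hence have a single term in each degree. *)
rewrite /nut /alphat /cst !(series_bilin_coef1 _ (series_bilin _ _ _)).
rewrite !(series_bilin_coef1 _ (series_lin _ _)).
rewrite !series_bilin_const !series_lin_const !def_nu0 !def_alpha0.
move/esym/eqP; rewrite -subr_eq0 => /eqP <-.
rewrite /dt_nu /d_nunu /d_alphanu.
rewrite !opprD !opprK !addrA.
by rewrite [RHS](ACl (10*4*2*8*6*12*9*3*5*11*7*1)%AC).
Qed.

(** Multiplicativity at order t, with the same sign: the term in which the
    twist applies to [nu_1] enters positively. *)
Lemma dt_alpha_deformation (H : {group G}) (a b : fixed psi H) :
  dt_alpha (def_nu D H 1) (def_alpha D H 1) a b = 0.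
Proof.
have := def_mult D a b 1.
rewrite /nut /alphat /cst (series_bilin_coef1 _ (series_lin _ _)).
rewrite (series_lin_coef1 _ (series_bilin _ _ _)).
rewrite !series_bilin_const !series_lin_const !def_nu0 !def_alpha0.
move/esym/eqP; rewrite -subr_eq0 => /eqP <-.
rewrite /dt_alpha /d_nualpha /d_alphaalpha.
rewrite !opprD !opprK !addrA.
by rewrite [RHS](ACl (1*5*3*4*2)%AC).
Qed.

Lemma infinitesimal_invariant : invariant2 (infinitesimal D).
Proof.
move=> g H L sHL; split=> [a b|a].
  have := def_nu_nat D sHL a b 1.
  by rewrite /nut /alphat /cst /series_map !series_bilin_const.
have := def_alpha_nat D sHL a 1.
by rewrite /nut /alphat /cst /series_map !series_lin_const.
Qed.

End Infinitesimal.

Theorem theorem5p3 (K : fieldType) (charK0 : [pchar K] =i pred0)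
    (G : finGroupType) (A : homPreLieType K) (regA : regular A)
    (psi : hpl_action G A) (D : eqv_deformation psi) :
  eqv_cocycle2 (infinitesimal D).
Proof.
split; first exact: infinitesimal_invariant.
by move=> H; split=> *; [exact: dt_nu_deformation | exact: dt_alpha_deformation].
Qed.
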